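(* (a) Let $R$ be a subring of a ring $Q$. Then every nonzero right ideal of $R$ is right invertible in $Q$ if and only if every nonzero completely prime right ideal of $R$ is right invertible in $Q$. (b) Let $R$ be a right Ore ring with classical right ring of quotients $Q$. Then $R$ is a right hereditary right noetherian domain if and only if every nonzero completely prime right ideal of $R$ is right invertible in $Q$.
   Context: Rings are associative with $1$; subrings share the same $1$. A right ideal $P\subsetneq R$ is completely prime if for all $a,b\in R$ with $aP\subseteq P$, $ab\in P$ implies $a\in P$ or $b\in P$. For a subring $R\subseteq Q$ and a right $R$-submodule $I\subseteq Q$, let $I^*:=\{q\in Q: qI\subseteq R\}$. Such an $I$ is right invertible in $Q$ if there exist $n$ and $x_1,\dots,x_n\in I$, $q_1,\dots,q_n\in I^*$ such that $\sum_{i} x_iq_i=1$. An element of $R$ is regular if it is neither a left nor a right zero-divisor. A ring $R$ is right Ore if the multiplicative set $S$ of its regular elements satisfies $aS\cap sR\neq\varnothing$ for all $a\in R$, $s\in S$; equivalently, $R$ has a classical right ring of quotients $Q=RS^{-1}$ (a ring $Q\supseteq R$ in which every regular element of $R$ is invertible and every element has the form $rs^{-1}$ with $r\in R$, $s\in S$). A ring is right hereditary if all of its right ideals are projective, and right noetherian if all of its right ideals are finitely generated. A domain is a ring, not necessarily commutative, in which the product of any two nonzero elements is nonzero. *)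

(* Defs.v *)
(* Rings are [pzRingType]s, so the zero ring is allowed. *)
From HB Require Import structures.
From mathcomp Require Import all_boot all_algebra.
From mathcomp Require Import boolp classical_sets.

Set Implicit Arguments.
Unset Strict Implicit.
Unset Printing Implicit Defensive.

Import GRing.Theory.
Local Open Scope classical_set_scope.
Local Open Scope ring_scope.

Record rightIdeal (R : pzRingType) := RightIdeal {
  rideal_set :> R -> Prop;
  rideal0 : rideal_set 0;
  ridealD : forall x y, rideal_set x -> rideal_set y -> rideal_set (x + y);
  ridealM : forall x r, rideal_set x -> rideal_set (x * r)
}.

(* A right R-module is a left module over the opposite ring R^c. In particular
   R^c^o is R as a right module over itself, with r *: x equal to x * r in R. *)
Definition rideal_pred (R : pzRingType) (I : rightIdeal R) : {pred R^c^o} :=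
  fun x => `[< I x >].

Lemma rideal_submod_closed (R : pzRingType) (I : rightIdeal R) :
  submod_closed (rideal_pred I).
Proof.
split; first exact/asboolP/rideal0.
move=> a u v /asboolP Iu /asboolP Iv; apply/asboolP.
by apply: ridealD => //; apply: (@ridealM R I u a).
Qed.

HB.instance Definition _ (R : pzRingType) (I : rightIdeal R) :=
  GRing.isSubmodClosed.Build R^c R^c^o (rideal_pred I) (rideal_submod_closed I).

Definition rideal_module (R : pzRingType) (I : rightIdeal R) :=
  {x : R^c^o | x \in rideal_pred I}.

HB.instance Definition _ (R : pzRingType) (I : rightIdeal R) :=
  SubType.on (rideal_module I).
HB.instance Definition _ (R : pzRingType) (I : rightIdeal R) :=
  Choice.on (rideal_module I).
HB.instance Definition _ (R : pzRingType) (I : rightIdeal R) :=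
  [SubChoice_isSubLmodule of rideal_module I by <:].

Definition projective (A : pzRingType) (P : lmodType A) : Prop :=
  forall (M N : lmodType A) (g : {linear M -> N}) (f : {linear P -> N}),
    (forall y, exists x, g x = y) ->
    exists h : {linear P -> M}, forall p, g (h p) = f p.

Definition finitely_generated (R : pzRingType) (I : rightIdeal R) : Prop :=
  exists (n : nat) (x : 'I_n -> R),
    forall y, I y <-> exists r : 'I_n -> R, y = \sum_(i < n) x i * r i.

Definition right_hereditary (R : pzRingType) : Prop :=
  forall I : rightIdeal R, projective (rideal_module I).

Definition right_noetherian (R : pzRingType) : Prop :=
  forall I : rightIdeal R, finitely_generated I.

Definition is_domain (R : pzRingType) : Prop :=
  forall a b : R, a <> 0 -> b <> 0 -> a * b <> 0.

Definition nonzero_rideal (R : pzRingType) (I : rightIdeal R) : Prop :=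
  exists x, I x /\ x <> 0.

Definition completely_prime (R : pzRingType) (P : rightIdeal R) : Prop :=
  (exists x, ~ P x) /\
  forall a b : R, (forall p, P p -> P (a * p)) -> P (a * b) -> P a \/ P b.

(* In what follows R is regarded as a subring of Q through an injective ring
   morphism iota, and I is a subset of Q. *)
Definition dual (R Q : pzRingType) (iota : {rmorphism R -> Q}) (I : set Q) :
    set Q :=
  [set q | forall x, I x -> range iota (q * x)].

Definition right_invertible (R Q : pzRingType) (iota : {rmorphism R -> Q})
    (I : set Q) : Prop :=
  exists (n : nat) (x q : 'I_n -> Q),
    [/\ forall i, I (x i), forall i, dual iota I (q i) &
        \sum_(i < n) x i * q i = 1].

Definition regular_elt (R : pzRingType) (s : R) : Prop :=
  GRing.lreg s /\ GRing.rreg s.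

Definition right_ore (R : pzRingType) : Prop :=
  forall a s : R, regular_elt s ->
    exists b t : R, regular_elt t /\ a * t = s * b.

Definition is_inverse (Q : pzRingType) (u v : Q) : Prop :=
  u * v = 1 /\ v * u = 1.

Definition classical_right_quotient_ring (R Q : pzRingType)
    (iota : {rmorphism R -> Q}) : Prop :=
  [/\ injective iota,
      forall s : R, regular_elt s -> exists v, is_inverse (iota s) v &
      forall q : Q, exists (r s : R) (v : Q),
        [/\ regular_elt s, is_inverse (iota s) v & q = iota r * v]].

(* Main.v *)
From HB Require Import structures.
Require Import Defs.
From mathcomp Require Import all_boot all_algebra.
From mathcomp Require Import boolp classical_sets.

(** Part (a) is an instance of the principle that a right ideal maximal with
    respect to failing a property is completely prime, as soon as the property
    satisfies an Oka condition.  Invertibility of [I] is witnessed by finitely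
    many elements of [I] and of [I^*], and shrinking an ideal enlarges its dual; so
    non-invertibility passes to unions of chains, and by Zorn's lemma a
    non-invertible [I] lies below a maximal non-invertible [P]
    ([maximal_noninvertible]).  The Oka condition is that [P] is invertible
    whenever [P + aR] and [a^-1 P] are ([right_invertible_oka]).  If [aP] is
    contained in [P], [ab] is in [P], and neither [a] nor [b] is, then both of
    these strictly contain [P], hence are invertible by maximality, and then so
    is [P]: a contradiction.  Thus [P] is completely prime, and nonzero because
    it contains [I].

    By (a), part (b) is about rings in which all nonzero right ideals are
    invertible.  A relation [\sum_i x_i q_i = 1] with [x_i] in [I] and [q_i] in
    [I^*] says that [y = \sum_i x_i (q_i y)] on [I], i.e. that the [x_i] and the
    functionals [y |-> q_i y] form a dual basis of [I]; so [I] is finitely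
    generated and projective.  Invertibility of [bR], for [b] nonzero, makes [b]
    right invertible in [Q], so that [b] cannot be killed from the left, and [R] is a
    domain.  Conversely, a finitely generated projective [I] has a dual basis,
    and over a right Ore domain each functional on a nonzero [I] is left
    multiplication by an element of [Q] ([functional_is_lmul]); evaluating the
    dual basis relation at a nonzero element of [I], which is a unit of [Q],
    gives back [\sum_i x_i q_i = 1]. *)

Set Implicit Arguments.
Unset Strict Implicit.
Unset Printing Implicit Defensive.

Import GRing.Theory.
Local Open Scope classical_set_scope.
Local Open Scope ring_scope.

(** * Right ideals *)

Lemma ridealB (R : pzRingType) (I : rightIdeal R) x y : I x -> I y -> I (x - y).
Proof.
by move=> Ix Iy; apply: ridealD => //; rewrite -mulrN1; apply: ridealM.
Qed.

Lemma rideal_sum (R : pzRingType) (I : rightIdeal R) n (x : 'I_n -> R) :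
  (forall i, I (x i)) -> I (\sum_i x i).
Proof.
by move=> Ix; apply: big_ind => //; [apply: rideal0 | apply: ridealD].
Qed.

Definition rideal_adjoin (R : pzRingType) (I : rightIdeal R) (a : R) :
  rightIdeal R.
Proof.
exists (fun x => exists p r, I p /\ x = p + a * r).
- by exists 0, 0; split; [exact: rideal0 | rewrite mulr0 addr0].
- move=> _ _ [p [r [Ip ->]]] [p' [r' [Ip' ->]]]; exists (p + p'), (r + r').
  by split; [exact: ridealD | rewrite mulrDr addrACA].
- move=> _ s [p [r [Ip ->]]]; exists (p * s), (r * s).
  by split; [exact: ridealM | rewrite mulrDl mulrA].
Defined.

Definition rideal_colon (R : pzRingType) (a : R) (I : rightIdeal R) :
  rightIdeal R.
Proof.
exists (fun r => I (a * r)).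
- by rewrite mulr0; exact: rideal0.
- by move=> x y Ix Iy; rewrite mulrDr; exact: ridealD.
- by move=> x r Ix; rewrite mulrA; exact: ridealM.
Defined.

Definition rideal_principal (R : pzRingType) (a : R) : rightIdeal R.
Proof.
exists (fun x => exists r, x = a * r).
- by exists 0; rewrite mulr0.
- by move=> _ _ [r ->] [s ->]; exists (r + s); rewrite mulrDr.
- by move=> _ s [r ->]; exists (r * s); rewrite mulrA.
Defined.

Definition rideal_bigcup (R : pzRingType) (A : set (rightIdeal R))
  (A0 : A !=set0)
  (Atot : total_on A (fun I J => rideal_set I `<=` rideal_set J)) :
  rightIdeal R.
Proof.
exists (fun x => exists2 I, A I & rideal_set I x).
- by have [I AI] := A0; exists I => //; exact: rideal0.
- move=> x y [I AI Ix] [J AJ Jy].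
  have [IJ|JI] := Atot _ _ AI AJ.
    by exists J => //; apply: ridealD => //; apply: IJ.
  by exists I => //; apply: ridealD => //; apply: JI.
- by move=> x r [I AI Ix]; exists I => //; exact: ridealM.
Defined.

(** * Right invertibility *)

Lemma dual_imageP (R Q : pzRingType) (iota : {rmorphism R -> Q})
    (I : rightIdeal R) q :
  dual iota (iota @` rideal_set I) q <->
  forall x, I x -> exists r, iota r = q * iota x.
Proof.
split=> [dq x Ix|dq _ [x Ix <-]].
  by have [|r _ <-] := dq (iota x); [exists x | exists r].
by have [r rE] := dq x Ix; exists r.
Qed.

Lemma right_invertibleP (R Q : pzRingType) (iota : {rmorphism R -> Q})
    (I : rightIdeal R) :
  right_invertible iota (iota @` rideal_set I) <->
  exists n (x : 'I_n -> R) (q : 'I_n -> Q),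
    [/\ forall i, I (x i), forall i, dual iota (iota @` rideal_set I) (q i) &
        \sum_i iota (x i) * q i = 1].
Proof.
split=> [[n [y [q [Iy dq yq1]]]]|[n [x [q [Ix dq xq1]]]]]; last first.
  by exists n, (iota \o x), q; split=> // i; exists (x i).
have /choice[x xP] : forall i, exists x, I x /\ iota x = y i.
  by move=> i; have [x Ix <-] := Iy i; exists x.
exists n, x, q; split=> // [i|]; first by case: (xP i).
by rewrite -yq1; apply: eq_bigr => i _; have [_ ->] := xP i.
Qed.

(** If [\sum_i (p_i + a r_i) q_i = 1] and [\sum_j k_j t_j = 1] witness the
    invertibility of [P + aR] and of [K = a^-1 P], put [s = \sum_i r_i q_i].
    Then [\sum_i p_i q_i + a s = 1], so for [p] in [P] the element
    [a (s p) = p - \sum_i p_i (q_i p)] is in [P]; hence [s P] is contained in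
    [K] and every [t_j s] is in [P^*].  Therefore
    [1 = \sum_i p_i q_i + \sum_j (a k_j) (t_j s)] is a witness for [P]. *)
Lemma right_invertible_oka (R Q : pzRingType) (iota : {rmorphism R -> Q})
    (P : rightIdeal R) (a : R) :
  injective iota ->
  right_invertible iota (iota @` rideal_set (rideal_adjoin P a)) ->
  right_invertible iota (iota @` rideal_set (rideal_colon a P)) ->
  right_invertible iota (iota @` rideal_set P).
Proof.
move=> iota_inj /right_invertibleP[n [x [q [xP qP xq1]]]].
move=> /right_invertibleP[m [k [t [kP tP kt1]]]]; apply/right_invertibleP.
have /choice[p /choice[r prP]] := xP.
pose s := \sum_i iota (r i) * q i.
have pqE : \sum_i iota (p i) * q i = 1 - iota a * s.
  apply/eqP; rewrite eq_sym subr_eq -xq1 mulr_sumr -big_split /=; apply/eqP.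
  apply: eq_bigr => i _; have [_ ->] := prP i.
  by rewrite rmorphD rmorphM mulrDl mulrA.
have dq i : dual iota (iota @` rideal_set P) (q i).
  apply/dual_imageP => y Py; have /dual_imageP := qP i; apply.
  by exists y, 0; rewrite mulr0 addr0.
have sK y : P y -> exists2 u, P (a * u) & iota u = s * iota y.
  move=> Py.
  have /choice[c cE] : forall i, exists c, iota c = q i * iota y.
    by move=> i; have /dual_imageP := dq i; apply.
  (* [s y = \sum_i r_i (q_i y)] and every [q_i y] is in [R], so [s y] is too *)
  exists (\sum_i r i * c i); last first.
    rewrite rmorph_sum mulr_suml; apply: eq_bigr => i _.
    by rewrite rmorphM cE mulrA.
  suff -> : a * \sum_i r i * c i = y - \sum_i p i * c i.
    apply: ridealB => //; apply: rideal_sum => i; apply: ridealM.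
    by case: (prP i).
  apply: iota_inj; rewrite rmorphB rmorphM !rmorph_sum /=.
  have -> : \sum_i iota (p i * c i) = (1 - iota a * s) * iota y.
    rewrite -pqE mulr_suml; apply: eq_bigr => i _.
    by rewrite rmorphM cE mulrA.
  rewrite mulrBl mul1r subKr -mulrA mulr_suml; congr (_ * _).
  by apply: eq_bigr => i _; rewrite rmorphM cE mulrA.
exists (n + m)%N,
  (fun i => match split i with inl i => p i | inr j => a * k j end),
  (fun i => match split i with inl i => q i | inr j => t j * s end).
split=> [i|i|].
- by case: (split i) => j; [case: (prP j) | exact: kP].
- case: (split i) => j //; apply/dual_imageP => y /sK[u Pau uE].
  by rewrite -mulrA -uE; have /dual_imageP := tP j; apply.
rewrite big_split_ord /=.
under eq_bigr => i _ do rewrite (unsplitK (inl i)).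
under [X in _ + X]eq_bigr => j _ do
  rewrite (unsplitK (inr j)) rmorphM -mulrA (mulrA (iota _) (t j)).
by rewrite pqE -mulr_sumr -mulr_suml kt1 mul1r subrK.
Qed.

(** * Maximal non-invertible right ideals *)

Lemma maximal_noninvertible (R Q : pzRingType) (iota : {rmorphism R -> Q})
    (I : rightIdeal R) :
  ~ right_invertible iota (iota @` rideal_set I) ->
  exists P : rightIdeal R,
    [/\ rideal_set I `<=` rideal_set P,
        ~ right_invertible iota (iota @` rideal_set P) &
        forall J : rightIdeal R, rideal_set P `<=` rideal_set J ->
          ~ (rideal_set J `<=` rideal_set P) ->
          right_invertible iota (iota @` rideal_set J)].
Proof.
move=> ninvI.
pose T := {J : rightIdeal R | rideal_set I `<=` rideal_set J /\
                              ~ right_invertible iota (iota @` rideal_set J)}.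
pose le (J K : T) := `[< rideal_set (sval J) `<=` rideal_set (sval K) >].
have I_T : T by exists I; split.
have [|J K L /asboolP JK /asboolP KL|A Atot|P maxP] := @ZL_preorder T I_T le.
- by move=> J; apply/asboolP.
- by apply/asboolP => x /JK/KL.
- have [[J0 AJ0]|A0] := pselect (exists J, A J); last first.
    by exists I_T => J AJ; case: A0; exists J.
  pose B := sval @` A.
  have Btot : total_on B (fun J K => rideal_set J `<=` rideal_set K).
    move=> _ _ [J AJ <-] [K AK <-].
    by have [/asboolP|/asboolP] := Atot _ _ AJ AK; [left|right].
  have B0 : B !=set0 by exists (sval J0); exists J0.
  pose U := rideal_bigcup B0 Btot.
  have subU J : A J -> rideal_set (sval J) `<=` rideal_set U.
    by move=> AJ x Jx; exists (sval J) => //; exists J.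
  suff UT : rideal_set I `<=` rideal_set U /\
            ~ right_invertible iota (iota @` rideal_set U).
    by exists (exist _ U UT) => J AJ; apply/asboolP; apply: subU.
  split; first by move=> x Ix; apply: (subU J0 AJ0); apply: (svalP J0).1.
  move=> /right_invertibleP[n [x [q [Ux dq xq1]]]].
  (* the finitely many [x_i] already lie in one member of the chain *)
  have [J AJ Jx] : exists2 J : T, A J & forall i, rideal_set (sval J) (x i).
    have : forall s : seq 'I_n,
        exists2 J : T, A J & forall i, i \in s -> rideal_set (sval J) (x i).
      elim=> [|i s [J AJ Js]]; first by exists J0.
      have [_ [K AK <-] Kx] := Ux i.
      have [/asboolP JK|/asboolP KJ] := Atot _ _ AJ AK.
        exists K => // j; rewrite inE => /orP[/eqP->//|/Js]; exact: JK.
      exists J => // j; rewrite inE => /orP[/eqP->|/Js//]; exact: KJ.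
    move=> /(_ (enum 'I_n))[J AJ Js]; exists J => // i.
    by apply: Js; rewrite mem_enum.
  apply: (svalP J).2; apply/right_invertibleP; exists n, x, q; split=> // i.
  apply/dual_imageP => y Jy; have /dual_imageP := dq i; apply.
  exact: subU Jy.
exists (sval P); split; [exact: (svalP P).1 | exact: (svalP P).2 |].
move=> J PJ nJP; apply: contrapT => ninvJ; apply: nJP.
have JT : rideal_set I `<=` rideal_set J /\
          ~ right_invertible iota (iota @` rideal_set J).
  by split=> // x /(svalP P).1; exact: PJ.
by have /asboolP := maxP (exist _ J JT) (asboolT PJ).
Qed.

Lemma maximal_noninvertible_completely_prime (R Q : pzRingType)
    (iota : {rmorphism R -> Q}) (P : rightIdeal R) :
  injective iota ->
  ~ right_invertible iota (iota @` rideal_set P) ->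
  (forall J : rightIdeal R, rideal_set P `<=` rideal_set J ->
     ~ (rideal_set J `<=` rideal_set P) ->
     right_invertible iota (iota @` rideal_set J)) ->
  completely_prime P.
Proof.
move=> iota_inj ninvP maxP; split=> [|a b aP Pab].
  (* the unit ideal is invertible, with witness [1 * 1 = 1] *)
  exists 1 => P1; apply: ninvP; apply/right_invertibleP.
  exists 1%N, (fun=> 1), (fun=> 1); split=> // [_|].
    by apply/dual_imageP => x _; exists x; rewrite mul1r.
  by rewrite big_ord1 rmorph1 mulr1.
have [Pa|nPa] := pselect (P a); first by left.
have [Pb|nPb] := pselect (P b); first by right.
case: ninvP; apply: (@right_invertible_oka _ _ _ _ a) => //.
  apply: maxP => [p Pp|sub]; first by exists p, 0; rewrite mulr0 addr0.
  apply: nPa; apply: sub; exists 0, 1.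
  by rewrite mulr1 add0r; split=> //; exact: rideal0.
by apply: maxP => [p /aP//|sub]; apply: nPb; apply: sub.
Qed.

Lemma right_invertible_from_completely_prime (R Q : pzRingType)
    (iota : {rmorphism R -> Q}) :
  injective iota ->
  (forall P : rightIdeal R, nonzero_rideal P -> completely_prime P ->
     right_invertible iota (iota @` rideal_set P)) ->
  forall I : rightIdeal R,
    nonzero_rideal I -> right_invertible iota (iota @` rideal_set I).
Proof.
move=> iota_inj cpP I [x [Ix x0]]; apply: contrapT.
move=> /maximal_noninvertible[P [IP ninvP maxP]]; apply: (ninvP).
apply: cpP; first by exists x; split=> //; exact: IP.
exact: maximal_noninvertible_completely_prime maxP.
Qed.

(** * Dual bases *)

Definition dual_basis (A : pzRingType) (P : lmodType A) n (x : 'I_n -> P)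
  (c : 'I_n -> {linear P -> A^o}) :=
  forall y, y = \sum_i (c i y : A) *: x i.

Lemma dual_basis_projective (A : pzRingType) (P : lmodType A) n
    (x : 'I_n -> P) (c : 'I_n -> {linear P -> A^o}) :
  dual_basis x c -> projective P.
Proof.
move=> xc M N g f g_surj.
have /choice[m mE] : forall i, exists m, g m = f (x i) by [].
pose h y := \sum_i (c i y : A) *: m i.
have h_linear : linear h.
  move=> a u v; rewrite /h scaler_sumr -big_split /=.
  by apply: eq_bigr => i _; rewrite linearP scalerDl scalerA.
pose hL := GRing.isLinear.Build A P M *:%R h h_linear.
exists (HB.pack_for {linear P -> M} h hL) => y /=.
rewrite /h [in RHS](xc y) !linear_sum; apply: eq_bigr => i _.
by rewrite !linearZ_LR mE.
Qed.

(** Lifting the identity through the surjection [A^n -> P] given by a finite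
    generating family and taking coordinates yields the functionals. *)
Lemma projective_dual_basis (A : pzRingType) (P : lmodType A) n
    (x : 'I_n -> P) :
  projective P -> (forall y, exists r : 'I_n -> A, y = \sum_i r i *: x i) ->
  exists c : 'I_n -> {linear P -> A^o}, dual_basis x c.
Proof.
move=> projP x_gen.
pose g (v : 'rV[A]_n) := \sum_i v 0 i *: x i.
have g_linear : linear g.
  move=> a u v; rewrite /g scaler_sumr -big_split /=.
  by apply: eq_bigr => i _; rewrite !mxE scalerDl scalerA.
pose gL := GRing.isLinear.Build A 'rV[A]_n P *:%R g g_linear.
pose G : {linear 'rV[A]_n -> P} := HB.pack g gL.
have [y|h hE] := projP _ _ G (idfun : {linear P -> P}).
  have [r ->] := x_gen y; exists (\row_i r i).
  by apply: eq_bigr => i _; rewrite mxE.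
have c_linear i : linear (fun y => h y 0 i : A^o).
  by move=> a u v; rewrite linearP !mxE.
pose cL i := GRing.isLinear.Build A P A^o *:%R _ (c_linear i).
exists (fun i => HB.pack_for {linear P -> A^o} (fun y => h y 0 i : A^o) (cL i)).
by move=> y; rewrite -[LHS]hE.
Qed.

(** * Right ideals as modules *)

Definition rideal_elt (R : pzRingType) (I : rightIdeal R) (x : R) (Ix : I x) :
  rideal_module I := exist _ (x : R^c^o) (asboolT Ix).

Lemma rideal_moduleP (R : pzRingType) (I : rightIdeal R) (y : rideal_module I) :
  I (val y).
Proof. exact/asboolP/(valP y). Qed.

Lemma val_rideal_comb (R : pzRingType) (I : rightIdeal R) n
    (x : 'I_n -> rideal_module I) (r : 'I_n -> R^c) :
  val (\sum_i r i *: x i) = \sum_i (val (x i) : R) * (r i : R) :> R.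
Proof. by rewrite raddf_sum; apply: eq_bigr. Qed.

Lemma dual_basis_finitely_generated (R : pzRingType) (I : rightIdeal R) n
    (x : 'I_n -> rideal_module I)
    (c : 'I_n -> {linear rideal_module I -> R^c^o}) :
  dual_basis x c -> finitely_generated I.
Proof.
move=> xc; exists n, (fun i => val (x i)) => y; split=> [Iy|[r ->]].
  exists (fun i => c i (rideal_elt Iy)).
  by rewrite -val_rideal_comb -xc.
by apply: rideal_sum => i; apply/ridealM/rideal_moduleP.
Qed.

(** The functionals are the multiplications [y |-> q_i y]. *)
Lemma right_invertible_dual_basis (R Q : pzRingType) (iota : {rmorphism R -> Q})
    (I : rightIdeal R) :
  injective iota -> right_invertible iota (iota @` rideal_set I) ->
  exists n (x : 'I_n -> rideal_module I)
    (c : 'I_n -> {linear rideal_module I -> R^c^o}), dual_basis x c.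
Proof.
move=> iota_inj /right_invertibleP[n [x [q [Ix dq xq1]]]].
have /choice[c cE] : forall i, exists c : rideal_module I -> R^c^o,
    forall y, iota (c y) = q i * iota (val y).
  move=> i; suff /choice : forall y : rideal_module I, exists r,
    iota r = q i * iota (val y) by case=> c cE; exists c.
  by move=> y; have /dual_imageP := dq i; apply; exact: rideal_moduleP.
have c_linear i : linear (c i).
  move=> a u v; apply: iota_inj.
  have -> : a *: c i u + c i v = (c i u : R) * (a : R) + (c i v : R) :> R by [].
  have vE : val (a *: u + v) = (val u : R) * (a : R) + (val v : R) :> R by [].
  by rewrite rmorphD rmorphM !cE vE rmorphD rmorphM mulrDr mulrA.
pose cL i :=
  GRing.isLinear.Build R^c (rideal_module I) R^c^o *:%R _ (c_linear i).
exists n, (fun i => rideal_elt (Ix i)),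
  (fun i => HB.pack_for {linear rideal_module I -> R^c^o} (c i) (cL i)).
move=> y; apply/val_inj/iota_inj.
rewrite val_rideal_comb rmorph_sum /= -[LHS]mul1r -xq1 mulr_suml.
by apply: eq_bigr => i _; rewrite rmorphM cE mulrA.
Qed.

Lemma zero_rideal_module (R : pzRingType) (I : rightIdeal R) :
  ~ nonzero_rideal I -> forall y : rideal_module I, y = 0.
Proof.
move=> I0 y; apply: val_inj; apply: contrapT => y0; apply: I0.
by exists (val y); split=> //; exact: rideal_moduleP.
Qed.

Lemma all_rideals_dual_basis (R Q : pzRingType) (iota : {rmorphism R -> Q}) :
  injective iota ->
  (forall I : rightIdeal R,
     nonzero_rideal I -> right_invertible iota (iota @` rideal_set I)) ->
  forall I : rightIdeal R, exists n (x : 'I_n -> rideal_module I)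
    (c : 'I_n -> {linear rideal_module I -> R^c^o}), dual_basis x c.
Proof.
move=> iota_inj invR I.
have [nzI|zI] := pselect (nonzero_rideal I).
  exact: right_invertible_dual_basis (invR I nzI).
exists 0%N, (fun=> 0), (fun=> \0) => y.
by rewrite big_ord0; exact: zero_rideal_module.
Qed.

(** * Domains *)

(** If [bR] is invertible then [b] has a right inverse in [Q], so [ab = 0]
    forces [a = 0]. *)
Lemma right_invertible_domain (R Q : pzRingType) (iota : {rmorphism R -> Q}) :
  injective iota ->
  (forall I : rightIdeal R,
     nonzero_rideal I -> right_invertible iota (iota @` rideal_set I)) ->
  is_domain R.
Proof.
move=> iota_inj invR a b a0 b0 ab0; apply: a0; apply: iota_inj.
have nzb : nonzero_rideal (rideal_principal b).
  by exists b; split=> //; exists 1; rewrite mulr1.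
have /right_invertibleP[n [x [q [xb _ xq1]]]] := invR _ nzb.
rewrite rmorph0 -[LHS]mulr1 -xq1 mulr_sumr big1 // => i _.
by have [r ->] := xb i; rewrite mulrA -rmorphM mulrA ab0 mul0r rmorph0 mul0r.
Qed.

Lemma domain_regular (R : pzRingType) (s : R) :
  is_domain R -> s <> 0 -> regular_elt s.
Proof.
move=> domR s0; split.
  by apply: mulrI0_lreg => y sy0; apply: contrapT => y0; exact: domR sy0.
by apply: mulIr0_rreg => y ys0; apply: contrapT => y0; exact: domR ys0.
Qed.

(** The value [f x] at one nonzero [x] determines [f]: given [y] in [I], the
    Ore condition provides a common right multiple [yt = xb] with [t] regular,
    and then [f(y) t = f(yt) = f(xb) = f(x) b], so that
    [f(y) = f(x) b t^-1 = (f(x) x^-1) y]. *)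
Lemma functional_is_lmul (R Q : pzRingType) (iota : {rmorphism R -> Q})
    (I : rightIdeal R) (f : {linear rideal_module I -> R^c^o})
    (x y : rideal_module I) (v : Q) :
  right_ore R -> classical_right_quotient_ring iota ->
  regular_elt (val x : R) -> is_inverse (iota (val x)) v ->
  iota (f y) = iota (f x) * v * iota (val y).
Proof.
move=> oreR [_ regU _] regx [xv vx].
have [b [t [regt ytxb]]] := oreR (val y) (val x) regx.
have ftb : (f y : R) * t = (f x : R) * b.
  have e : (t : R^c) *: y = (b : R^c) *: x by apply: val_inj.
  by have := congr1 f e; rewrite !linearZ_LR.
have [w [tw _]] := regU t regt.
rewrite -[LHS]mulr1 -[RHS]mulr1 -tw !mulrA; congr (_ * w).
rewrite -rmorphM ftb rmorphM -!mulrA; congr (_ * _).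
by rewrite -rmorphM ytxb rmorphM mulrA vx mul1r.
Qed.

Lemma dual_basis_right_invertible (R Q : pzRingType)
    (iota : {rmorphism R -> Q}) (I : rightIdeal R) n
    (x : 'I_n -> rideal_module I)
    (c : 'I_n -> {linear rideal_module I -> R^c^o}) :
  right_ore R -> classical_right_quotient_ring iota -> is_domain R ->
  nonzero_rideal I -> dual_basis x c ->
  right_invertible iota (iota @` rideal_set I).
Proof.
move=> oreR quotR domR [z [Iz z0]] xc.
have regz := domain_regular domR z0.
have [_ regU _] := quotR; have [v vP] := regU z regz.
pose Z := rideal_elt Iz.
have cE i y : iota (c i y) = iota (c i Z) * v * iota (val y).
  exact: functional_is_lmul.
apply/right_invertibleP.
exists n, (fun i => val (x i)), (fun i => iota (c i Z) * v); split=> [i|i|].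
- exact: rideal_moduleP.
- apply/dual_imageP => y Iy.
  by exists (c i (rideal_elt Iy)); exact: cE.
have zE : \sum_i (val (x i) : R) * (c i Z : R) = z.
  by rewrite -val_rideal_comb -xc.
rewrite -vP.1 -zE rmorph_sum mulr_suml.
by apply: eq_bigr => i _; rewrite rmorphM mulrA.
Qed.

Lemma finitely_generated_projective_dual_basis (R : pzRingType)
    (I : rightIdeal R) :
  projective (rideal_module I) -> finitely_generated I ->
  exists n (x : 'I_n -> rideal_module I)
    (c : 'I_n -> {linear rideal_module I -> R^c^o}), dual_basis x c.
Proof.
move=> projI [n [x xI]].
have Ix i : I (x i).
  apply/xI; exists (fun j => (j == i)%:R).
  rewrite (bigD1 i) //= eqxx mulr1 big1 ?addr0 // => j /negbTE ->.
  by rewrite mulr0.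
exists n, (fun i => rideal_elt (Ix i)); apply: projective_dual_basis => // y.
have /xI[r yE] := rideal_moduleP y; exists r.
by apply: val_inj; rewrite val_rideal_comb.
Qed.

Theorem proposition5p21 :
  (forall (R Q : pzRingType) (iota : {rmorphism R -> Q}),
     injective iota ->
     (forall I : rightIdeal R,
        nonzero_rideal I -> right_invertible iota (iota @` rideal_set I)) <->
     (forall P : rightIdeal R, nonzero_rideal P -> completely_prime P ->
        right_invertible iota (iota @` rideal_set P)))
  /\
  (forall (R Q : pzRingType) (iota : {rmorphism R -> Q}),
     right_ore R -> classical_right_quotient_ring iota ->
     ([/\ right_hereditary R, right_noetherian R & is_domain R] <->
      (forall P : rightIdeal R, nonzero_rideal P -> completely_prime P ->
         right_invertible iota (iota @` rideal_set P)))).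
Proof.
split=> R Q iota.
  move=> iota_inj; split=> [invR P nzP _|]; first exact: invR.
  exact: right_invertible_from_completely_prime.
move=> oreR quotR; have [iota_inj _ _] := quotR.
split=> [[herR noeR domR] P nzP _|cpR].
  have [n [x [c xc]]] :=
    finitely_generated_projective_dual_basis (herR P) (noeR P).
  exact: dual_basis_right_invertible xc.
have invR := right_invertible_from_completely_prime iota_inj cpR.
have dbR := all_rideals_dual_basis iota_inj invR.
split=> [I|I|].
- by have [n [x [c /dual_basis_projective]]] := dbR I.
- by have [n [x [c /dual_basis_finitely_generated]]] := dbR I.
- exact: right_invertible_domain invR.
Qed.
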